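(* Let $(\mathfrak{g},\eta)$ be a DS-contact Lie algebra with Reeb vector $\xi$, and put $\mathfrak{t}:=\ker\operatorname{ad}_\xi$, $\mathfrak{q}:=\operatorname{im}\operatorname{ad}_\xi$, $\mathfrak{t}_0:=\mathfrak{t}\cap\ker\eta$. Assume $\mathfrak{q}\neq0$ and $\dim\mathfrak{t}\geq3$. Then $\omega_{\mathfrak{t}}:=-(d\eta)|_{\mathfrak{t}_0}$ is an exact symplectic form on the Lie algebra $\mathfrak{t}_0$. Thus, neither $\mathfrak{t}_0$ nor $\mathfrak{t}$ is unimodular.
   Context: All Lie algebras are real and finite-dimensional. A contact Lie algebra is a pair $(\mathfrak{g},\eta)$ with $\dim\mathfrak{g}=2n+1$ and $\eta\in\mathfrak{g}^*$ such that $\eta\wedge(d\eta)^n\neq 0$, where $d\eta(x,y)=-\eta([x,y])$. Its Reeb vector is the unique $\xi\in\mathfrak{g}$ with $\eta(\xi)=1$ and $d\eta(\xi,\cdot)=0$. It is DS-contact if $\mathfrak{g}=\ker\operatorname{ad}_\xi\oplus\operatorname{im}\operatorname{ad}_\xi$ as vector spaces. In this case $\mathfrak{t}$ is a Lie subalgebra, $\mathfrak{t}=\mathbb{R}\xi\oplus\mathfrak{t}_0$ with $\xi$ central in $\mathfrak{t}$, and $\mathfrak{t}_0$ is a Lie algebra with bracket $\alpha(x,y):=$ the $\mathfrak{t}_0$-component of $[x,y]$, so that $[x,y]=\omega_{\mathfrak{t}}(x,y)\xi+\alpha(x,y)$ for $x,y\in\mathfrak{t}_0$; here $\omega_{\mathfrak{t}}(x,y)=\eta([x,y])$.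 A symplectic form on a Lie algebra $\mathfrak{a}$ is a nondegenerate closed $2$-form; it is exact if it equals $d\lambda$ for some $\lambda\in\mathfrak{a}^*$, where $d\lambda(x,y)=-\lambda([x,y])$. A Lie algebra is unimodular if all its adjoint operators are traceless. *)

(* Defs.v *)
From mathcomp Require Import all_boot all_order all_fingroup all_algebra.
From mathcomp Require Import reals.

Set Implicit Arguments.
Unset Strict Implicit.
Unset Printing Implicit Defensive.

Import GRing.Theory.
Local Open Scope ring_scope.

Section ExteriorForms.
Context {R : realType} {V : vectType R}.

Definition kform (k : nat) := ('I_k -> V) -> R.

Definition wedge (p q : nat) (a : kform p) (b : kform q) : kform (p + q) :=
  fun v => ((p`! * q`!)%:R)^-1 *
    \sum_(s : 'S_(p + q)) (-1) ^+ (s : bool) *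
      a (fun i => v (s (lshift q i))) * b (fun j => v (s (rshift p j))).

(* The return type typechecks because [m.+1 * 2] and [2 + m * 2] are
   convertible. *)
Fixpoint form_pow (w : kform 2) (n : nat) : kform (n * 2) :=
  match n with
  | 0 => fun _ => 1
  | m.+1 => wedge w (@form_pow w m)
  end.

Definition kform1 (l : 'Hom(V, R^o)) : kform 1 := fun v => l (v ord0).

Definition kform2 (w : V -> V -> R) : kform 2 := fun v => w (v ord0) (v ord_max).

Definition two_form (w : V -> V -> R) : Prop :=
  bilinear_for *%R *%R w /\ forall x, w x x = 0.

Definition nondegenerate (w : V -> V -> R) : Prop :=
  forall x, (forall y, w x y = 0) -> x = 0.

End ExteriorForms.

Arguments form_pow {R V} w n _.

Section LieAlgebras.
Context {R : realType} {V : vectType R}.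
Variable br : V -> V -> V.

Definition lie_bracket : Prop :=
  [/\ bilinear_for *:%R *:%R br,
      forall x, br x x = 0 &
      forall x y z, br x (br y z) + br y (br z x) + br z (br x y) = 0].

(* [linfun f] agrees with [f] only when [f] is linear, which holds here under
   [lie_bracket]. *)
Definition ad (x : V) : 'End(V) := linfun (br x).

Definition lie_subalgebra (U : {vspace V}) : Prop :=
  forall x y, x \in U -> y \in U -> br x y \in U.

(* [vsproj U] is the coercion of elements of U into [subvs_of U]; the result is
   the restricted bracket when U is a subalgebra. *)
Definition restr_br (U : {vspace V}) (x y : subvs_of U) : subvs_of U :=
  vsproj U (br (vsval x) (vsval y)).

Definition lfun_trace (f : 'End(V)) : R :=
  \tr (passmx.mxof (vbasis fullv) (vbasis fullv) f).

Definition unimodular : Prop := forall x, lfun_trace (ad x) = 0.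

(* Chevalley-Eilenberg differentials in degrees 1 and 2. *)
Definition d1 (l : 'Hom(V, R^o)) (x y : V) : R := - l (br x y).

Definition d2 (w : V -> V -> R) (x y z : V) : R :=
  - w (br x y) z + w (br x z) y - w (br y z) x.

Definition symplectic_form (w : V -> V -> R) : Prop :=
  [/\ two_form w, nondegenerate w & forall x y z, d2 w x y z = 0].

Definition exact_form (w : V -> V -> R) : Prop :=
  exists l : 'Hom(V, R^o), forall x y, w x y = d1 l x y.

Definition contact (eta : 'Hom(V, R^o)) : Prop :=
  exists n : nat, \dim {:V} = (2 * n).+1 /\
    exists v, wedge (kform1 eta) (form_pow (kform2 (d1 eta)) n) v != 0.

Definition reeb (eta : 'Hom(V, R^o)) (xi : V) : Prop :=
  eta xi = 1 /\ forall y, d1 eta xi y = 0.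

Definition ker_ad (xi : V) : {vspace V} := lker (ad xi).
Definition im_ad (xi : V) : {vspace V} := limg (ad xi).

Definition ds_contact (eta : 'Hom(V, R^o)) (xi : V) : Prop :=
  [/\ contact eta, reeb eta xi,
      (ker_ad xi + im_ad xi)%VS = fullv & directv (ker_ad xi + im_ad xi)].

Definition ker_ad0 (eta : 'Hom(V, R^o)) (xi : V) : {vspace V} :=
  (ker_ad xi :&: lker eta)%VS.

(* [daddv_pi U W] is the projection of U + W onto U along W, so this takes the
   t0-component in the decomposition t = t0 + R xi. *)
Definition alpha_br (eta : 'Hom(V, R^o)) (xi : V)
    (x y : subvs_of (ker_ad0 eta xi)) : subvs_of (ker_ad0 eta xi) :=
  vsproj (ker_ad0 eta xi)
    (daddv_pi (ker_ad0 eta xi) <[xi]>%VS (br (vsval x) (vsval y))).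

Definition omega_t (eta : 'Hom(V, R^o)) (xi : V)
    (x y : subvs_of (ker_ad0 eta xi)) : R :=
  - d1 eta (vsval x) (vsval y).

End LieAlgebras.

Arguments alpha_br {R V} br eta xi x y.
Arguments omega_t {R V} br eta xi x y.
Arguments restr_br {R V} br U x y.

(* Main.v *)
From HB Require Import structures.
Require Import Defs.
From mathcomp Require Import all_boot all_order all_fingroup all_algebra.
From mathcomp Require Import boolp reals.
Set Implicit Arguments.
Unset Strict Implicit.
Unset Printing Implicit Defensive.
Import GRing.Theory Num.Theory.
Local Open Scope ring_scope.

(** Write A for ad xi.  It is a derivation, so for x in t it commutes with
    ad x; hence t is a subalgebra and [t, q] is contained in q.  Since the
    Reeb condition says that eta vanishes on q, the spaces t0 and q are
    orthogonal for d eta, and nondegeneracy of d eta on ker eta passes to t0;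
    the Jacobi identity makes omega_t closed and alpha a Lie bracket.

    Exactness is a trace argument.  A is invertible on q and A^-1 commutes with
    ad x for x in t, so tr_q (A^-1 [ad x, ad y]) = 0 for x, y in t
    ([twisted_trace_br]).  As [x, y] = omega_t(x, y) xi + alpha(x, y) on t0,
    this reads
      0 = omega_t(x, y) dim q + tr_q (A^-1 ad alpha(x, y)),
    so omega_t is the differential of z |-> tr_q (A^-1 ad z) / dim q
    ([omega_exact]); this is where q <> 0 enters.

    An exact symplectic form w = d l on a nonzero Lie algebra rules out
    unimodularity: choose x with w(x, _) = l; then ad x satisfies
    w([x, y], z) + w(y, [x, z]) = - w(y, z), an infinitesimal conformal
    symplectic map, and comparing traces gives 2 tr (ad x) = - dim
    ([exact_symplectic_not_unimodular]).  The dimension assumption on t makes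
    t0 nonzero.  Finally t is a central extension of t0 by xi, so both have the
    same traces of adjoint maps ([ad_trace_t0]).

    That d eta is nondegenerate on ker eta has to be extracted from the wedge
    product being nonzero: if x <> 0 is in the common kernel of eta and d eta,
    both are pulled back along a linear projection killing x, whose image has
    too small a dimension for a nonzero alternating form of top degree
    ([wedge_pow_nondegenerate]). *)

(** * Linear and bilinear maps *)

Section LinearMaps.
Context {K : fieldType} {U V : vectType K}.

(** [lfunE] asks for a bundled linear map; here linearity is a hypothesis. *)
Lemma linfunE (f : U -> V) : linear f -> forall u, linfun f u = f u.
Proof.
move=> fL u.
pose F : {linear U -> V} := HB.pack f (GRing.isLinear.Build K U V *:%R f fL).
exact: (lfunE F).
Qed.

Lemma daddv_pi_compl (U' W : {vspace U}) u :
  (U' :&: W = 0)%VS -> u \in W -> daddv_pi U' W u = 0.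
Proof.
move=> UW0 uW; have := daddv_pi_add UW0 (subvP (addvSr U' W) u uW).
rewrite (@daddv_pi_id _ _ W U') // 1?capvC // => /(canRL (addrK u)) ->.
exact: subrr.
Qed.

End LinearMaps.

Section AlternatingMaps.
Context {K : nzRingType} {U : lmodType K} {V : zmodType} (w : U -> U -> V).
Context {s s' : GRing.Scale.law K V} (wB : bilinear_for s s' w).
Hypothesis w0 : forall x, w x x = 0.

Lemma linear_forD (r : GRing.Scale.law K V) (f : U -> V) :
  GRing.linear_for r f -> {morph f : x y / x + y}.
Proof.
move=> /GRing.zmod_morphism_linear fB x y.
by rewrite -[y in LHS]opprK fB -[- y]sub0r fB -[0]subr0 fB subrr sub0r opprK.
Qed.

Lemma bilinDl x y z : w (x + y) z = w x z + w y z.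
Proof. exact: linear_forD (wB.1 z) x y. Qed.

Lemma bilinDr x y z : w z (x + y) = w z x + w z y.
Proof. exact: linear_forD (wB.2 z) x y. Qed.

Lemma altC x y : w x y = - w y x.
Proof.
by apply/eqP; rewrite -addr_eq0; have := w0 (x + y);
  rewrite bilinDl !bilinDr !w0 add0r addr0 => ->.
Qed.

End AlternatingMaps.

(** * Alternating multilinear forms and the wedge product *)

Section AlternatingForms.
Context {R : realType} {V : vectType R}.

(** Slots are overwritten in place, rather than split off, so that arguments
    can still be permuted freely. *)
Definition multilinear k (a : kform k) : Prop :=
  forall (v : 'I_k -> V) j c x y,
    a [eta v with j |-> c *: x + y] =
    c * a [eta v with j |-> x] + a [eta v with j |-> y].

Definition alternating k (a : kform k) : Prop :=
  forall (v : 'I_k -> V) i j, i != j -> v i = v j -> a v = 0.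

(** In the summand of a permutation s, the vector in slot j is fed to exactly
    one of the two factors, according to the side on which s^-1 j falls. *)
Lemma wedge_multilinear p q (a : @kform R V p) (b : kform q) :
  multilinear a -> multilinear b -> multilinear (wedge a b).
Proof.
move=> aM bM v j c x y; rewrite /wedge mulrCA -mulrDr; congr (_ * _).
rewrite mulr_sumr -big_split /=; apply: eq_bigr => s _.
have [i0|j0] := split_ordP ((s^-1)%g j).
- move=> /(canRL (permKV s)) ej.
  have eL z : (fun i => [eta v with j |-> z] (s (lshift q i))) =
              [eta (fun i => v (s (lshift q i))) with i0 |-> z].
    by apply: funext => i /=; rewrite ej (inj_eq perm_inj) (inj_eq (@lshift_inj _ _)).
  have eR z : (fun i => [eta v with j |-> z] (s (rshift p i))) =
              (fun i => v (s (rshift p i))).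
    by apply: funext => i /=; rewrite ej (inj_eq perm_inj) eq_rlshift.
  by rewrite !eL !eR aM mulrDr mulrDl !mulrA [c * _]mulrC.
- move=> /(canRL (permKV s)) ej.
  have eL z : (fun i => [eta v with j |-> z] (s (lshift q i))) =
              (fun i => v (s (lshift q i))).
    by apply: funext => i /=; rewrite ej (inj_eq perm_inj) eq_lrshift.
  have eR z : (fun i => [eta v with j |-> z] (s (rshift p i))) =
              [eta (fun i => v (s (rshift p i))) with j0 |-> z].
    by apply: funext => i /=; rewrite ej (inj_eq perm_inj) (inj_eq (@rshift_inj _ _)).
  by rewrite !eL !eR bM mulrDr mulrCA !mulrA.
Qed.

(** Reindexing the signed sum over all permutations by a transposition changes
    its sign. *)
Lemma wedge_alternating p q (a : @kform R V p) (b : kform q) :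
  alternating (wedge a b).
Proof.
move=> v i j ij vij; set t := tperm i j.
have vt : v \o t = v.
  by apply: funext => k /=; case: tpermP => [->|->|].
suff wN : wedge a b (v \o t) = - wedge a b v.
  by apply/eqP; rewrite -[_ == 0](mulrn_eq0 _ 2) mulr2n -{1}vt wN addNr.
rewrite /wedge -mulrN -sumrN; congr (_ * _).
rewrite (reindex_inj (mulIg t)) /=; apply: eq_bigr => s _.
rewrite odd_permM odd_tperm ij signr_addb expr1 mulrN1 !mulNr.
by congr (- (_ * a _ * b _)); apply: funext => k /=; rewrite permM tpermK.
Qed.

Lemma wedge_pullback p q (a : @kform R V p) (b : kform q) (f : V -> V) :
  (forall v, a (f \o v) = a v) -> (forall v, b (f \o v) = b v) ->
  forall v, wedge a b (f \o v) = wedge a b v.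
Proof.
move=> fa fb v; congr (_ * _); apply: eq_bigr => s _.
by congr (_ * _ * _); [rewrite -[RHS]fa | rewrite -[RHS]fb].
Qed.

(** A linear relation with a nonzero coefficient at v_j is substituted into
    slot j; every other term of the expansion has a repeated vector. *)
Lemma alternating_free k (a : @kform R V k) (v : 'I_k -> V) :
  multilinear a -> alternating a -> a v != 0 -> free [tuple v i | i < k].
Proof.
move=> aM aA av0; apply/freeP => c sum0 j; apply/eqP/negPn/negP => cj.
pose F : 'Hom(V, R^o) := linfun (fun x => a [eta v with j |-> x] : R^o).
have FE x : F x = a [eta v with j |-> x] by exact: (@linfunE R V R^o _ (aM v j)).
have : F (\sum_(i < k) c i *: [tuple v i | i < k]`_i) = 0 by rewrite sum0 linear0.
rewrite linear_sum (bigD1 j) //= big1 ?addr0; last first.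
  move=> i ij; rewrite linearZ nth_mktuple /= FE (aA _ i j) ?scaler0 //=.
  by rewrite (negPf ij) eqxx.
rewrite linearZ nth_mktuple /= FE => /eqP; rewrite scaler_eq0 (negPf cj) /=.
have -> : [eta v with j |-> v j] = v :> ('I_k -> V).
  by apply: funext => i /=; case: eqP => [->|].
by rewrite (negPf av0).
Qed.

Lemma kform1_multilinear (l : 'Hom(V, R^o)) : multilinear (kform1 l).
Proof. by move=> v j c x y; rewrite /kform1 /= (ord1 j) eqxx linearP. Qed.

Lemma kform2_multilinear (w : V -> V -> R) :
  bilinear_for *%R *%R w -> multilinear (kform2 w).
Proof.
move=> [wl wr] v j c x y; rewrite /kform2 /=.
case: (unliftP ord0 j) => [i|] ->; last by rewrite eqxx /= wl.
by rewrite (ord1 i) /= wr.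
Qed.

Lemma form_pow_multilinear (w : V -> V -> R) n :
  bilinear_for *%R *%R w -> multilinear (form_pow (kform2 w) n).
Proof.
move=> wB; elim: n => [v [] //|n IHn].
exact: wedge_multilinear (kform2_multilinear wB) IHn.
Qed.

Lemma form_pow_pullback (w : V -> V -> R) n (f : V -> V) :
  (forall x y, w (f x) (f y) = w x y) ->
  forall v, form_pow (kform2 w) n (f \o v) = form_pow (kform2 w) n v.
Proof.
move=> fw; elim: n => [//|n IHn] v.
by apply: (wedge_pullback _ IHn) => u; exact: fw.
Qed.

(** The projection f along <[x]> satisfies l (f y) = l y and
    w (f y) (f z) = w y z, so the form takes the same nonzero value at f \o v;
    then the f (v_i) are dim V free vectors in the image of a noninjective
    endomorphism. *)
Lemma wedge_pow_nondegenerate (l : 'Hom(V, R^o)) (w : V -> V -> R) n v x :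
  bilinear_for *%R *%R w -> (forall y, w y y = 0) ->
  \dim {:V} = (2 * n).+1 -> wedge (kform1 l) (form_pow (kform2 w) n) v != 0 ->
  l x = 0 -> (forall y, w x y = 0) -> x = 0.
Proof.
move=> wB w0 dimV nz lx wx; apply/eqP/negPn/negP => x0.
have wx' y : w y x = 0 by rewrite (altC wB w0) wx oppr0.
pose f : 'End(V) := (\1 - projv <[x]>)%VF.
have fE y : exists c, y = c *: x + f y.
  have /vlineP[c pc] := memv_proj <[x]> y.
  by exists c; rewrite add_lfunE opp_lfunE id_lfunE -pc addrC subrK.
have lf y : l (f y) = l y.
  have [c {2}->] := fE y.
  by rewrite [in RHS]linearP /= lx scaler0 add0r.
have wf y z : w (f y) (f z) = w y z.
  have [c {2}->] := fE y; have [d {2}->] := fE z.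
  have wl a b e u : w (a *: b + e) u = a * w b u + w e u by exact: wB.1.
  have wr a b e u : w u (a *: b + e) = a * w u b + w u e by exact: wB.2.
  by rewrite wl wx mulr0 add0r wr wx' mulr0 add0r.
have fx : f x = 0.
  by rewrite add_lfunE opp_lfunE id_lfunE projv_id ?memv_line // subrr.
have nzf : wedge (kform1 l) (form_pow (kform2 w) n) (f \o v) != 0.
  rewrite wedge_pullback // => [u|]; [exact: lf | exact: form_pow_pullback].
have aM := wedge_multilinear (kform1_multilinear l) (form_pow_multilinear (n := n) wB).
have := alternating_free aM (@wedge_alternating _ _ _ _) nzf.
move=> fr; have : (\dim {:V} <= \dim (limg f))%N.
  have <- : \dim <<[tuple (f \o v) i | i < 1 + n * 2]>> = \dim {:V}.
    by move/eqP: fr => ->; rewrite size_tuple dimV mulnC.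
  apply/dimvS/span_subvP => _ /mapP[i _ ->]; exact/memv_img/memvf.
have := limg_ker_dim f fullv; rewrite capfv => <-.
rewrite -[X in (_ <= X)%N]add0n leq_add2r leqn0 dimv_eq0 => /eqP k0.
by have := memv_ker f x; rewrite k0 memv0 fx eqxx (negPf x0).
Qed.

End AlternatingForms.

(** * Traces of endomorphisms *)

Section Trace.
Context {R : realType}.
Implicit Types U V : vectType R.

(** tr (g f) = tr (f g) for maps between different spaces.  The composites
    appear as A and B with pointwise equations, since in the uses they are
    adjoint maps or projections that are only pointwise composites. *)
Lemma lfun_trace_swap U V (f : 'Hom(U, V)) (g : 'Hom(V, U))
    (A : 'End(U)) (B : 'End(V)) :
  (forall x, A x = g (f x)) -> (forall y, B y = f (g y)) ->
  lfun_trace A = lfun_trace B.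
Proof.
move=> AE BE.
have -> : A = (g \o f)%VF by apply/lfunP => x; rewrite comp_lfunE.
have -> : B = (f \o g)%VF by apply/lfunP => y; rewrite comp_lfunE.
rewrite /lfun_trace !(passmx.mxof_comp _ (f := vbasis _)) ?vbasisP //.
exact: mxtrace_mulC.
Qed.

Lemma lfun_traceP V a (f g : 'End(V)) :
  lfun_trace (a *: f + g) = a * lfun_trace f + lfun_trace g.
Proof. by rewrite /lfun_trace passmx.mxof_linear linearP. Qed.

Lemma lfun_trace_id V : lfun_trace (\1%VF : 'End(V)) = (\dim {:V})%:R.
Proof. by rewrite /lfun_trace passmx.mxof1 ?mxtrace1 // (basis_free (vbasisP _)). Qed.

(** The projection factors as inclusion after corestriction, which compose in
    the other order to the identity of U. *)
Lemma lfun_trace_proj V (U W : {vspace V}) :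
  (U :&: W = 0)%VS -> lfun_trace (daddv_pi U W) = (\dim U)%:R.
Proof.
move=> UW0; pose p := linfun (fun x => vsproj U (daddv_pi U W x)).
pose i : 'Hom(subvs_of U, V) := linfun vsval.
have iE u : i u = vsval u by exact: lfunE.
have pE x : p x = vsproj U (daddv_pi U W x).
  by apply: linfunE => a y z; rewrite !linearP.
have <- : \dim {:subvs_of U} = \dim U by rewrite dimvf.
rewrite -lfun_trace_id.
apply: (lfun_trace_swap (f := p) (g := i)) => [x|u].
  by rewrite iE pE vsprojK // memv_pi.
by rewrite id_lfunE pE iE daddv_pi_id ?subvsP // vsvalK.
Qed.

Section Gram.
Context {V : vectType R} (w : V -> V -> R).
Hypotheses (wB : bilinear_for *%R *%R w) (wnd : Defs.nondegenerate w).
Let e := vbasis {:V}.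

Definition gram : 'M[R]_(\dim {:V}) := \matrix_(i, j) w e`_i e`_j.

Lemma gramE u v :
  w (passmx.vecof e u) (passmx.vecof e v) = (u *m gram *m v^T) 0 0.
Proof.
have wl a b z : w (a *: b) z = a * w b z.
  exact: GRing.scalable_linear (wB.1 z) a b.
have wr a b z : w z (a *: b) = a * w z b.
  exact: GRing.scalable_linear (wB.2 z) a b.
have w0l z : w 0 z = 0 by have := wl 0 0 z; rewrite scale0r mul0r.
have w0r z : w z 0 = 0 by have := wr 0 0 z; rewrite scale0r mul0r.
rewrite -mulmxA mxE /passmx.vecof.
rewrite (big_morph (w^~ _) (id1 := 0) (op1 := +%R)) => [|x y|//]; last exact: bilinDl wB x y _.
apply: eq_bigr => i _; rewrite wl; congr (_ * _); rewrite mxE.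
rewrite (big_morph (w _) (id1 := 0) (op1 := +%R)) => [|x y|//]; last exact: bilinDr wB x y _.
by apply: eq_bigr => j _; rewrite wr !mxE mulrC.
Qed.

Lemma gram_unit : gram \in unitmx.
Proof.
rewrite -row_free_unit -kermx_eq0; apply/rowV0P => u /sub_kermxP uG.
have eB := vbasisP {:V}.
apply/eqP; rewrite -(passmx.vecof_eq0 eB); apply/eqP/wnd => y.
by rewrite -(passmx.rVofK eB y) gramE uG mul0mx mxE.
Qed.

Lemma nondegenerate_dual (l : 'Hom(V, R^o)) : exists x, forall y, w x y = l y.
Proof.
have eB := vbasisP {:V}; pose lv : 'rV[R]_(\dim {:V}) := \row_i l e`_i.
exists (passmx.vecof e (lv *m invmx gram)) => y.
rewrite -(passmx.rVofK eB y) gramE mulmxKV ?gram_unit // mxE.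
rewrite linear_sum; apply: eq_bigr => i _.
by rewrite linearZ !mxE mulrC.
Qed.

(** In the basis e the hypothesis reads M G + G M^T = c G for the Gram matrix
    G; multiplying by G^-1 and taking traces gives 2 tr M = c dim V. *)
Lemma conformal_trace (L : 'End(V)) c :
  (forall y z, w (L y) z + w y (L z) = c * w y z) ->
  lfun_trace L *+ 2 = c * (\dim {:V})%:R.
Proof.
move=> Lw; have eB := vbasisP {:V}; pose M := passmx.mxof e e L.
have dE (A : 'M[R]_(\dim {:V})) i j :
    (delta_mx 0 i *m A *m delta_mx j 0) (0 : 'I_1) (0 : 'I_1) = A i j.
  by rewrite -rowE -colE !mxE.
have MG : M *m gram + gram *m M^T = c *: gram.
  apply/matrixP => i j; rewrite [LHS]mxE [RHS]mxE.
  have := Lw (passmx.vecof e (delta_mx 0 i)) (passmx.vecof e (delta_mx 0 j)).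
  rewrite !(passmx.hom_vecof _ eB) !gramE trmx_mul !trmx_delta.
  by rewrite -(mulmxA (delta_mx 0 i)) (mulmxA _ M^T) -(mulmxA _ gram M^T) !dE.
have : \tr ((M *m gram + gram *m M^T) *m invmx gram) = c * (\dim {:V})%:R.
  by rewrite MG -scalemxAl mulmxV ?gram_unit // mxtraceZ mxtrace1.
rewrite mulmxDl mulmxK ?gram_unit // mxtraceD -mulmxA mxtrace_mulC.
by rewrite mulmxKV ?gram_unit // mxtrace_tr mulr2n.
Qed.

End Gram.
End Trace.

(** * Lie algebras with an exact symplectic form *)

Section LieBracket.
Context {R : realType} {V : vectType R} {br : V -> V -> V}.
Hypothesis br_lie : lie_bracket br.

Let brB : bilinear_for *:%R *:%R br. Proof. by case: br_lie. Qed.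
Let br0 x : br x x = 0. Proof. by case: br_lie. Qed.

Lemma adE x y : ad br x y = br x y.
Proof. exact: (linfunE (brB.2 x)). Qed.

Lemma brC x y : br x y = - br y x.
Proof. exact: altC brB br0 x y. Qed.

Lemma br_jacobi x y z : br x (br y z) = br (br x y) z + br y (br x z).
Proof.
case: br_lie => _ _ /(_ x y z) J.
rewrite (brC (br x y)) (brC x z) -[br y (- _)]adE linearN /= adE.
by apply/eqP; rewrite -subr_eq0 opprD !opprK addrA addrAC J.
Qed.

Lemma d1_bilinear (l : 'Hom(V, R^o)) : bilinear_for *%R *%R (d1 br l).
Proof.
split=> z a x y; rewrite /d1 /=; [rewrite brB.1|rewrite brB.2];
  by rewrite linearP /= opprD mulrN.
Qed.

Lemma d1_alt (l : 'Hom(V, R^o)) x : d1 br l x x = 0.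
Proof. by rewrite /d1 br0 linear0 oppr0. Qed.

Lemma contact_nondegenerate (l : 'Hom(V, R^o)) x :
  contact br l -> l x = 0 -> (forall y, d1 br l x y = 0) -> x = 0.
Proof.
move=> [n [dimV [v nz]]].
exact: wedge_pow_nondegenerate (d1_bilinear l) (@d1_alt l) dimV nz.
Qed.

(** For w = d l and w(x, _) = l, the Jacobi identity gives
    w([x, y], z) + w(y, [x, z]) = - l [x, [y, z]] = l [y, z] = - w(y, z),
    and [conformal_trace] with c = -1 makes tr (ad x) negative. *)
Lemma exact_symplectic_not_unimodular (w : V -> V -> R) :
  (0 < \dim {:V})%N -> symplectic_form br w -> exact_form br w ->
  ~ unimodular br.
Proof.
move=> dimV [[wB w0] wnd _] [l wl] umod.
have [x wx] := nondegenerate_dual wB wnd l.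
have Lw y z : w (ad br x y) z + w y (ad br x z) = -1 * w y z.
  rewrite mulN1r !adE !wl /d1 opprK -opprD.
  by rewrite -(linearD l) -br_jacobi -[LHS](wl x) wx.
have := conformal_trace wB wnd Lw; rewrite umod mul0rn mulN1r => /esym/eqP.
by rewrite oppr_eq0 pnatr_eq0 -leqn0 leqNgt dimV.
Qed.

End LieBracket.

(** * The decomposition of a DS-contact Lie algebra *)

Section DSContact.
Context {R : realType} {g : vectType R} {br : g -> g -> g}.
Context {eta : 'Hom(g, R^o)} {xi : g}.
Hypotheses (br_lie : lie_bracket br) (g_ds : ds_contact br eta xi).

Local Notation t := (ker_ad br xi).
Local Notation q := (im_ad br xi).
Local Notation t0 := (ker_ad0 br eta xi).
Local Notation alpha := (alpha_br br eta xi).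
Local Notation omega := (omega_t br eta xi).
Local Notation pit := (daddv_pi t q).

Let brB : bilinear_for *:%R *:%R br. Proof. by case: br_lie. Qed.
Let br0 x : br x x = 0. Proof. by case: br_lie. Qed.
Let brBr x y z : br x (y - z) = br x y - br x z.
Proof. by rewrite -!(adE br_lie) linearB. Qed.
Let brZr a x y : br x (a *: y) = a *: br x y.
Proof. by rewrite -!(adE br_lie) linearZ. Qed.
Let br0r x : br x 0 = 0.
Proof. by rewrite -(adE br_lie) linear0. Qed.

Lemma eta_reeb : eta xi = 1. Proof. by case: g_ds => _ []. Qed.

Let eta_line c : eta (c *: xi) = c.
Proof. by rewrite linearZ /= eta_reeb; exact: mulr1. Qed.

Lemma eta_br_reeb y : eta (br xi y) = 0.
Proof. by case: g_ds => _ [_ /(_ y)/eqP]; rewrite oppr_eq0 => /eqP. Qed.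

Lemma mem_t x : (x \in t) = (br xi x == 0).
Proof. by rewrite memv_ker (adE br_lie). Qed.

Lemma mem_t0 x : (x \in t0) = (br xi x == 0) && (eta x == 0).
Proof. by rewrite memv_cap mem_t memv_ker. Qed.

Lemma br_mem_q y : br xi y \in q.
Proof. by rewrite -(adE br_lie) memv_img ?memvf. Qed.

Lemma q_br u : u \in q -> exists y, u = br xi y.
Proof. by case/memv_imgP => y _ ->; exists y; rewrite (adE br_lie). Qed.

Lemma tIq : (t :&: q = 0)%VS.
Proof. by case: g_ds => _ _ _; rewrite directv_addE => /and3P[_ _ /eqP]. Qed.

Lemma t_reeb x : x \in t -> br x xi = 0.
Proof. by rewrite mem_t (brC br_lie x) => /eqP->; rewrite oppr0. Qed.

(** ad xi is a derivation that kills x. *)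
Lemma reeb_br_comm x y : x \in t -> br xi (br x y) = br x (br xi y).
Proof.
rewrite mem_t => /eqP xix; rewrite (br_jacobi br_lie xi) xix.
by rewrite (brC br_lie 0) br0r oppr0 add0r.
Qed.

Lemma br_t x y : x \in t -> y \in t -> br x y \in t.
Proof.
move=> xt; rewrite !mem_t => /eqP xiy.
by rewrite reeb_br_comm // xiy br0r.
Qed.

Lemma br_tq x u : x \in t -> u \in q -> br x u \in q.
Proof. by move=> xt /q_br[y ->]; rewrite -reeb_br_comm // br_mem_q. Qed.

Lemma sub_pit_q y : y - pit y \in q.
Proof.
case: g_ds => _ _ tq _.
rewrite -{1}(daddv_pi_add tIq (w := y)) ?tq ?memvf //.
by rewrite addrAC subrr add0r memv_pi.
Qed.

Lemma pit_br x y : x \in t -> pit (br x y) = br x (pit y).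
Proof.
move=> xt; have /(daddv_pi_compl tIq) := br_tq xt (sub_pit_q y).
rewrite brBr linearB /= => /eqP; rewrite subr_eq0 => /eqP ->.
by rewrite [LHS](daddv_pi_id tIq) // br_t ?memv_pi.
Qed.

Lemma t_sub_eta z : z \in t -> z - eta z *: xi \in t0.
Proof.
rewrite mem_t mem_t0 brBr brZr br0 scaler0 subr0 => ->.
by rewrite linearB /= eta_line subrr eqxx.
Qed.

Lemma t0Ireeb : (t0 :&: <[xi]> = 0)%VS.
Proof.
apply/eqP; rewrite -subv0; apply/subvP => z /memv_capP[zt0 /vlineP[c zc]].
move: zt0; rewrite mem_t0 zc eta_line => /andP[_ /eqP->].
by rewrite scale0r mem0v.
Qed.

Lemma pi_t0 z : z \in t -> daddv_pi t0 <[xi]> z = z - eta z *: xi.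
Proof.
move=> zt; rewrite -{1}[z](subrK (eta z *: xi)) linearD /=.
rewrite (daddv_pi_id t0Ireeb (t_sub_eta zt)).
by rewrite daddv_pi_compl ?t0Ireeb ?addr0 // memvZ // memv_line.
Qed.

Lemma t0_t (x : subvs_of t0) : vsval x \in t.
Proof. by have := subvsP x; rewrite memv_cap => /andP[]. Qed.

Lemma eta_t0 (x : subvs_of t0) : eta (vsval x) = 0.
Proof. by apply/eqP; have := subvsP x; rewrite mem_t0 => /andP[]. Qed.

Lemma omegaE x y : omega x y = eta (br (vsval x) (vsval y)).
Proof. by rewrite /omega_t /d1 opprK. Qed.

Lemma alphaE x y :
  vsval (alpha x y) = br (vsval x) (vsval y) - omega x y *: xi.
Proof.
have xy : br (vsval x) (vsval y) \in t by rewrite br_t ?t0_t.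
by rewrite /alpha_br vsprojK ?memv_pi // pi_t0 // omegaE.
Qed.

Let vsvalP a (x y : subvs_of t0) :
  vsval (a *: x + y) = a *: vsval x + vsval y.
Proof. exact: linearP. Qed.

Lemma alpha_lie : lie_bracket alpha.
Proof.
split=> [|x|x y z].
- split=> z a x y; apply: subvs_inj; rewrite !vsvalP !alphaE !omegaE;
    rewrite vsvalP ?brB.1 ?brB.2 (linearP eta) /=;
    by rewrite scalerDl -scalerA scalerBr opprD addrACA.
- by apply: subvs_inj; rewrite alphaE omegaE /= br0 linear0 scale0r subr0.
- apply: subvs_inj.
  have alpha2 (a b c : subvs_of t0) (d := br (vsval a) (br (vsval b) (vsval c))) :
      vsval (alpha a (alpha b c)) = d - eta d *: xi.
    rewrite alphaE omegaE alphaE brBr brZr t_reeb ?t0_t //.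
    by rewrite scaler0 subr0.
  rewrite !raddfD /= !alpha2.
  case: br_lie => _ _ /(_ (vsval x) (vsval y) (vsval z)) J.
  rewrite (addrACA _ (- _)) -opprD -scalerDl (addrACA _ (- _)) -opprD -scalerDl J.
  by rewrite -!(linearD eta) J linear0 scale0r subr0.
Qed.

Lemma eta_br_tq x u : x \in t -> u \in q -> eta (br x u) = 0.
Proof. by move=> xt uq; have /q_br[y ->] := br_tq xt uq; exact: eta_br_reeb. Qed.

(** By eta [t, q] = 0, a vector of t0 that is omega_t-orthogonal to t0 is
    d eta-orthogonal to everything, so it vanishes by the contact condition. *)
Lemma omega_symplectic : symplectic_form alpha omega.
Proof.
split.
- split=> [|x]; last by rewrite omegaE br0 linear0.
  by split=> z a x y; rewrite !omegaE vsvalP ?brB.1 ?brB.2 (linearP eta).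
- move=> x x_ker; apply: subvs_inj; rewrite /=.
  case: g_ds => ctc _ _ _.
  apply: (contact_nondegenerate br_lie ctc (eta_t0 x)) => y.
  apply/eqP; rewrite oppr_eq0.
  (* y splits into its q-part, a multiple of xi and its t0-part *)
  rewrite -[y](subrK (pit y)) -(adE br_lie) linearD /= (linearD eta).
  rewrite !(adE br_lie) /= eta_br_tq ?t0_t ?sub_pit_q // add0r.
  have pt : pit y \in t by exact: memv_pi.
  have := x_ker (vsproj t0 (pit y - eta (pit y) *: xi)).
  rewrite omegaE vsprojK ?t_sub_eta // brBr brZr t_reeb ?t0_t //.
  by rewrite scaler0 subr0 => ->.
- move=> x y z.
  have om (a b c : subvs_of t0) :
      omega (alpha a b) c = - eta (br (vsval c) (br (vsval a) (vsval b))).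
    rewrite omegaE (brC br_lie) alphaE brBr brZr t_reeb ?t0_t //.
    by rewrite scaler0 subr0 linearN.
  rewrite /d2 !om !opprK.
  case: br_lie => _ _ /(_ (vsval x) (vsval y) (vsval z)) /(congr1 eta).
  rewrite linear0 => <-; rewrite !(linearD eta) /= addrC [_ - _]addrC addrA.
  rewrite (brC br_lie (vsval z) (vsval x)) -[br _ (- _)](adE br_lie) linearN /=.
  by rewrite (adE br_lie) linearN.
Qed.

(** At most one dimension is lost, t0 being the kernel of a functional on t. *)
Lemma dim_t0 : (\dim t <= (\dim t0).+1)%N.
Proof.
rewrite -(limg_ker_dim eta t) -addn1 leq_add2l.
by apply: leq_trans (dimvS (subvf _)) _; rewrite dimvf.
Qed.

(** * Exactness of omega_t *)

(** D is ad xi on q and the identity on t, hence invertible on the whole space;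
    its inverse E extends the inverse of ad xi on q. *)
Local Notation D := (ad br xi + pit)%VF.

Let DE y : D y = br xi y + pit y.
Proof. by rewrite add_lfunE (adE br_lie). Qed.

Lemma D_ker0 : lker D == 0%VS.
Proof.
rewrite -subv0; apply/subvP => y; rewrite memv_ker DE memv0 => /eqP Dy.
have pity : pit y = 0.
  have := congr1 pit Dy; rewrite linearD linear0 /= (daddv_pi_compl tIq (br_mem_q y)).
  by rewrite add0r daddv_pi_proj // tIq.
have yt : y \in t by rewrite mem_t -Dy pity addr0.
by rewrite -(daddv_pi_id tIq yt) pity.
Qed.

Local Notation E := (D^-1)%VF.

Lemma E_reeb y : E (br xi y) = daddv_pi q t y.
Proof.
apply: (can_inj (lker0_lfunK D_ker0)); rewrite (lker0_lfunVK D_ker0) DE.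
rewrite (daddv_pi_compl tIq) ?memv_pi // addr0.
case: g_ds => _ _ tq _; rewrite -{1}(daddv_pi_add tIq (w := y)) ?tq ?memvf //.
rewrite -!(adE br_lie) linearD /= !(adE br_lie).
by have := memv_pi t q y; rewrite mem_t => /eqP ->; rewrite add0r.
Qed.

Lemma E_br x y : x \in t -> E (br x y) = br x (E y).
Proof.
move=> xt; apply: (can_inj (lker0_lfunK D_ker0)); rewrite (lker0_lfunVK D_ker0).
rewrite DE pit_br // reeb_br_comm // -{1}[y](lker0_lfunVK D_ker0) DE.
by rewrite -!(adE br_lie x) linearD.
Qed.

(** For z in t this is tr_q (ad(xi)^-1 ad z) + tr_t (ad z).  The second term
    vanishes on brackets and on xi, so working on the whole space, without
    restricting to q, yields a primitive of omega_t just as well. *)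
Definition twisted_trace (z : g) : R := lfun_trace (E \o ad br z)%VF.

Lemma twisted_traceP a x y :
  twisted_trace (a *: x + y) = a * twisted_trace x + twisted_trace y.
Proof.
rewrite /twisted_trace -lfun_traceP; congr lfun_trace; apply/lfunP => z.
rewrite add_lfunE scale_lfunE !comp_lfunE !(adE br_lie) (brB.1 z a x y) /=.
exact: linearP.
Qed.

Lemma twisted_trace_reeb : twisted_trace xi = (\dim q)%:R.
Proof.
rewrite -(@lfun_trace_proj _ _ q t) 1?capvC ?tIq //; congr lfun_trace.
by apply/lfunP => y; rewrite comp_lfunE (adE br_lie) E_reeb.
Qed.

(** E commutes with ad x and ad y, so E [ad x, ad y] is the commutator of
    E (ad x) and ad y. *)
Lemma twisted_trace_br x y :
  x \in t -> y \in t -> twisted_trace (br x y) = 0.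
Proof.
move=> xt yt.
have -> : twisted_trace (br x y) =
    lfun_trace ((E \o ad br x) \o ad br y)%VF -
    lfun_trace (ad br y \o (E \o ad br x))%VF.
  rewrite -mulN1r addrC -lfun_traceP; congr lfun_trace; apply/lfunP => z.
  rewrite add_lfunE scale_lfunE !comp_lfunE !(adE br_lie) -E_br // scaleN1r.
  rewrite [RHS]addrC -(linearB E); congr (E _).
  by rewrite (br_jacobi br_lie x) addrK.
rewrite (lfun_trace_swap (f := ad br y) (g := (E \o ad br x)%VF)
  (B := (ad br y \o (E \o ad br x))%VF)) ?subrr // => z; by rewrite comp_lfunE.
Qed.

(** Apply [twisted_trace] to [x, y] = omega_t(x, y) xi + alpha(x, y). *)
Lemma omega_exact : q <> 0%VS -> exact_form alpha omega.
Proof.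
move=> /eqP q0; have dq : (\dim q)%:R != 0 :> R by rewrite pnatr_eq0 dimv_eq0.
exists (linfun (fun z : subvs_of t0 => twisted_trace (vsval z) / (\dim q)%:R : R^o)).
move=> x y; rewrite /d1 linfunE => [|a u v]; last first.
  by rewrite vsvalP twisted_traceP mulrDl -mulrA.
rewrite alphaE [br _ _ - _]addrC -[- (_ *: xi)]scaleNr twisted_traceP.
by rewrite twisted_trace_br ?t0_t // addr0 twisted_trace_reeb mulfK // opprK.
Qed.

(** * Traces on t and on t0 *)

(** The map ad x on t kills xi, so it factors through the projection p of t
    onto t0 along xi as f p, and p f is the adjoint map of x in t0. *)
Lemma ad_trace_t0 (x : subvs_of t0) :
  lfun_trace (ad (restr_br br t) (vsproj t (vsval x))) = lfun_trace (ad alpha x).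
Proof.
have vt (y : subvs_of t0) : vsval (vsproj t (vsval y)) = vsval y.
  by rewrite vsprojK // t0_t.
pose p := linfun (fun y : subvs_of t => vsproj t0 (daddv_pi t0 <[xi]> (vsval y))).
have pE y : p y = vsproj t0 (daddv_pi t0 <[xi]> (vsval y)).
  by apply: linfunE => a u v; rewrite !linearP.
pose f := linfun (fun y : subvs_of t0 => vsproj t (br (vsval x) (vsval y))).
have fE y : f y = vsproj t (br (vsval x) (vsval y)).
  by apply: linfunE => a u v; rewrite vsvalP brB.2 linearP.
apply: (lfun_trace_swap (f := p) (g := f)) => y.
  have yt := subvsP y.
  rewrite fE pE vsprojK ?memv_pi // pi_t0 // brBr brZr t_reeb ?t0_t //.
  rewrite scaler0 subr0 linfunE /restr_br ?vt // => a u v.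
  by rewrite /restr_br linearP /= brB.2 linearP.
rewrite (adE alpha_lie) pE fE /alpha_br vsprojK //.
by rewrite br_t ?t0_t.
Qed.

End DSContact.

(** * The theorem *)

Theorem theorem1p3 (R : realType) (g : vectType R) (br : g -> g -> g)
    (br_lie : lie_bracket br) (eta : 'Hom(g, R^o)) (xi : g)
    (g_ds : ds_contact br eta xi)
    (q_neq0 : im_ad br xi <> 0%VS)
    (dim_t : (3 <= \dim (ker_ad br xi))%N) :
  [/\ lie_subalgebra br (ker_ad br xi) /\
      lie_bracket (alpha_br br eta xi),
      symplectic_form (alpha_br br eta xi) (omega_t br eta xi),
      exact_form (alpha_br br eta xi) (omega_t br eta xi),
      ~ unimodular (alpha_br br eta xi) &
      ~ unimodular (restr_br br (ker_ad br xi))].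
Proof.
have dt0 : (0 < \dim {:subvs_of (ker_ad0 br eta xi)})%N.
  by rewrite dimvf -ltnS (leq_trans _ (dim_t0 (br := br))) // (leq_trans _ dim_t).
have sym := omega_symplectic br_lie g_ds.
have exa := omega_exact br_lie g_ds q_neq0.
have alphaL := alpha_lie br_lie g_ds.
have num := exact_symplectic_not_unimodular alphaL dt0 sym exa.
split=> //; first by split=> //; exact: br_t.
move=> umod; apply: num => x.
by rewrite -(ad_trace_t0 br_lie g_ds); exact: umod.
Qed.
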